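(* Fix an integer $n\ge 1$ and let $\delta=2t+1$, where $t$ is a nonnegative integer with $t<n$. Suppose that \[ \delta-1+\left\lfloor\sqrt{\delta-1}\right\rfloor\left\lfloor\frac{\sqrt{4(\delta-1)+1}-1}{2}\right\rfloor>\frac{t(t+1)}{2}. \] Then perfect linear flag-rank-metric codes in $\mathrm{U}(n,\mathbb{F}_q)$ with minimum distance $\delta$ do not exist for all sufficiently large prime powers $q$; that is, there is $q_0=q_0(n,t)$ such that for every prime power $q\ge q_0$ there is no perfect linear flag-rank-metric code in $\mathrm{U}(n,\mathbb{F}_q)$ with minimum distance $\delta$.
   Context: $\mathbb{F}_q$ is the finite field with $q$ elements. $\mathrm{U}(n,\mathbb{F}_q)$ is the $\mathbb{F}_q$-vector space of $n\times n$ upper triangular matrices over $\mathbb{F}_q$. For $M\in \mathrm{U}(n,\mathbb{F}_q)$ and $1\le i\le n$, $M_{[i]}$ is the $i\times(n-i+1)$ submatrix of $M$ obtained by deleting the first $i-1$ columns and the last $n-i$ rows (i.e. rows $1,\dots,i$ and columns $i,\dots,n$). The flag-rank weight of $M$ is $\mathrm{fr}(M)=\sum_{i=1}^{n}\mathrm{rk}(M_{[i]})$; the flag-rank distance is $\mathrm{d}_{\mathrm{fr}}(A,B)=\mathrm{fr}(A-B)$. A linear flag-rank-metric code is an $\mathbb{F}_q$-subspace $\mathcal{C}$ of $\mathrm{U}(n,\mathbb{F}_q)$; its minimum (flag-rank) distance, defined when $\mathcal{C}\neq\{\boldsymbol{0}\}$, is $\delta=\min\{\mathrm{fr}(M):M\in\mathcal{C}\setminus\{\boldsymbol{0}\}\}$.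 Let $b_q(n,r)=|\{A\in \mathrm{U}(n,\mathbb{F}_q):\mathrm{fr}(A)\le r\}|$. A code $\mathcal{C}$ with minimum distance $\delta$ is perfect if $|\mathcal{C}|\,b_q\left(n,\left\lfloor\frac{\delta-1}{2}\right\rfloor\right)=q^{\frac{n(n+1)}{2}}$. *)

(* Defs.v *)
From HB Require Import structures.
From mathcomp Require Import all_boot all_order all_algebra.
Set Implicit Arguments.
Unset Strict Implicit.
Unset Printing Implicit Defensive.

Import GRing.Theory.
Local Open Scope ring_scope.

(* MathComp's [is_trig_mx] is lower triangularity. *)
Definition upper_trig (F : finFieldType) (n : nat) (M : 'M[F]_n) : bool :=
  is_trig_mx M^T.

Definition row_emb (n : nat) (i : 'I_n) (r : 'I_i.+1) : 'I_n :=
  widen_ord (ltn_ord i) r.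

Definition col_emb (n : nat) (i : 'I_n) (c : 'I_(n - i)) : 'I_n :=
  cast_ord (subnKC (ltnW (ltn_ord i))) (rshift i c).

(* Indices start at 0: for i : 'I_n this is the block usually written M_[i+1],
   made of the first i+1 rows and the last n-i columns of M. *)
Definition flag_block (F : finFieldType) (n : nat) (M : 'M[F]_n) (i : 'I_n) :
    'M[F]_(i.+1, n - i) :=
  mxsub (@row_emb n i) (@col_emb n i) M.

Definition flag_rank (F : finFieldType) (n : nat) (M : 'M[F]_n) : nat :=
  (\sum_(i < n) \rank (flag_block M i))%N.

Definition linear_flag_code (F : finFieldType) (n : nat)
    (C : {vspace 'M[F]_n}) : Prop :=
  forall M, M \in C -> upper_trig M.

(* No [delta] satisfies this when C is the zero code. *)
Definition min_distance (F : finFieldType) (n : nat)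
    (C : {vspace 'M[F]_n}) (delta : nat) : Prop :=
  (exists M, [/\ M \in C, M != 0 & flag_rank M = delta]) /\
  (forall M, M \in C -> M != 0 -> (delta <= flag_rank M)%N).

Definition ball_size (F : finFieldType) (n r : nat) : nat :=
  #|[set M : 'M[F]_n | upper_trig M && (flag_rank M <= r)%N]|.

Definition perfect_code (F : finFieldType) (n : nat)
    (C : {vspace 'M[F]_n}) (delta : nat) : Prop :=
  (#|C| * ball_size F n ((delta - 1) %/ 2) = #|F| ^ ((n * (n + 1)) %/ 2))%N.

(* Main.v *)
(** A matrix of flag rank at most [t] has at most [t] nonzero blocks, and an
entry [(r, c)] lies in the blocks [r] and [c]; so the matrix is supported on
the pairs [r <= c] of a set of at most [t] indices, and the ball of radius [t]
has at most [2^n * q^(t(t+1)/2)] elements. On the other hand the numerical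
hypothesis forces [1 <= t <= 5], and then the upper triangular matrices of
size [t], extended by one more diagonal entry, form a space of dimension
[t(t+1)/2 + 1] of flag rank at most [2t]. It meets a code of minimum distance
[2t + 1] trivially, so for a perfect code the ball has at least
[q^(t(t+1)/2 + 1)] elements, whence [q <= 2^n]. *)
Require Import Defs.
From mathcomp Require Import all_boot all_order all_algebra.
From mathcomp Require Import reals.
From mathcomp Require Import zify lra.
Import Order.TTheory GRing.Theory Num.Theory.
Local Open Scope ring_scope.

(** * Matrices with prescribed support *)

Definition supported_on (F : finFieldType) (n : nat) (D : {set 'I_n * 'I_n}) :
    {set 'M[F]_n} :=
  [set M : 'M[F]_n | [forall p, (M p.1 p.2 != 0) ==> (p \in D)]].

Lemma supported_onP (F : finFieldType) (n : nat) (D : {set 'I_n * 'I_n})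
    (M : 'M[F]_n) :
  reflect (forall r c, (r, c) \notin D -> M r c = 0) (M \in supported_on F n D).
Proof.
rewrite inE; apply: (iffP forallP) => [H r c | H [r c]].
  by apply: contraNeq => Mrc; apply: implyP (H (r, c)) Mrc.
by apply/implyP; apply: contraNT => /H /= ->.
Qed.

Lemma card_supported_on (F : finFieldType) (n : nat) (D : {set 'I_n * 'I_n}) :
  #|supported_on F n D| = (#|F| ^ #|D|)%N.
Proof.
pose g (M : 'M[F]_n) := [ffun p : 'I_n * 'I_n => M p.1 p.2].
have g_inj : injective g.
  by move=> A B /ffunP AB; apply/matrixP => r c; have := AB (r, c); rewrite !ffunE.
rewrite -(card_pffun_on (0 : F) D F) -(card_imset _ g_inj).
apply: eq_card => f; apply/imsetP/pffun_onP => [[M /supported_onP HM ->] | [fD _]].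
  split=> //; apply/subsetP => -[r c]; rewrite inE ffunE /=.
  by apply: contraNT => /HM ->.
exists (\matrix_(r, c) f (r, c)).
  apply/supported_onP => r c rcD; rewrite mxE; apply/eqP.
  by apply: contraNT rcD => frc; apply: (subsetP fD); rewrite inE.
by apply/ffunP => -[r c]; rewrite ffunE mxE.
Qed.

Definition upper_pairs (n : nat) (S : {set 'I_n}) : {set 'I_n * 'I_n} :=
  [set p | [&& p.1 \in S, p.2 \in S & (p.1 <= p.2)%N]].

(** The set and its mirror image under swapping coordinates meet in the diagonal of [S] and together
    fill the square of [S], so twice the cardinality is [#|S| * #|S| + #|S|]. *)
Lemma card_upper_pairs (n : nat) (S : {set 'I_n}) :
  #|upper_pairs n S| = ((#|S| * (#|S| + 1)) %/ 2)%N.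
Proof.
pose sw (p : 'I_n * 'I_n) := (p.2, p.1).
have sw_inj : injective sw by case=> a b [c d] [-> ->].
have cI : #|upper_pairs n S :&: (sw @^-1: upper_pairs n S)| = #|S|.
  rewrite -(card_imset (mem S) (f := fun i => (i, i))); last by move=> i j [].
  apply: eq_card => -[r c]; rewrite !inE /=; apply/idP/imsetP => [|[i iS [-> ->]]].
    case/andP=> /and3P [rS cS rc] /and3P [_ _ cr].
    by exists r => //; congr pair; apply/val_inj => /=; lia.
  by rewrite iS leqnn.
have cU : #|upper_pairs n S :|: (sw @^-1: upper_pairs n S)| = (#|S| * #|S|)%N.
  rewrite -cardsX; apply: eq_card => -[r c]; rewrite !inE /=.
  by have := leq_total r c; do !case: (_ \in S) => //=.
have := cardsUI (upper_pairs n S) (sw @^-1: upper_pairs n S).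
rewrite cI cU card_preimset // => cE.
have -> : (#|S| * (#|S| + 1) = #|upper_pairs n S| * 2)%N by lia.
by rewrite mulnK.
Qed.

Lemma upper_trigE (F : finFieldType) (n : nat) (M : 'M[F]_n) :
  upper_trig M = (M \in supported_on F n (upper_pairs n setT)).
Proof.
apply/is_trig_mxP/supported_onP => [H r c | H c r rc].
  by rewrite !inE /= -ltnNge => /H; rewrite mxE.
by rewrite mxE H // !inE /= -ltnNge.
Qed.

Lemma card_upper_trig (F : finFieldType) (n : nat) :
  #|[set M : 'M[F]_n | upper_trig M]| = (#|F| ^ ((n * (n + 1)) %/ 2))%N.
Proof.
have := card_upper_pairs n setT; rewrite cardsT card_ord => <-.
rewrite -card_supported_on.
by apply: eq_card => M; rewrite -upper_trigE inE.
Qed.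

(** * Upper bound for the ball *)

Lemma flag_block_eq0 (F : finFieldType) (n : nat) (M : 'M[F]_n) (i r c : 'I_n) :
  flag_block M i = 0 -> (r <= i <= c)%N -> M r c = 0.
Proof.
move=> /matrixP M0 /andP [ri ic].
(* The block starts at column [i] of [M], so column [c] of [M] is its column [c - i]. *)
have hc : (c - i < n - i)%N by have := ltn_ord c; lia.
have := M0 (Ordinal (ri : (r < i.+1)%N)) (Ordinal hc); rewrite !mxE => <-.
by congr (M _ _); apply/val_inj => //=; rewrite subnKC.
Qed.

Lemma ball_size_le (F : finFieldType) (n t : nat) :
  (ball_size F n t <= 2 ^ n * #|F| ^ ((t * (t + 1)) %/ 2))%N.
Proof.
have F_gt0 : (0 < #|F|)%N by apply/card_gt0P; exists 0.
pose P (S : {set 'I_n}) := (#|S| <= t)%N.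
have sub : [set M : 'M[F]_n | upper_trig M && (flag_rank M <= t)%N] \subset
    \bigcup_(S | P S) supported_on F n (upper_pairs n S).
  apply/subsetP => M; rewrite inE => /andP [utM frM].
  apply/bigcupP; exists [set i | \rank (flag_block M i) != 0%N].
    apply: leq_trans frM; rewrite /flag_rank cardsE -sum1_card.
    rewrite [leqRHS](bigID (fun i => \rank (flag_block M i) != 0%N)) /=.
    by apply: leq_trans (leq_addr _ _); apply: leq_sum => i; rewrite lt0n.
  apply/supported_onP => r c; rewrite !inE /=.
  case: (leqP r c) => [rc|cr _]; last first.
    move: utM; rewrite upper_trigE => /supported_onP -> //.
    by rewrite !inE /= -ltnNge.
  rewrite andbT negb_and !negbK !mxrank_eq0.
  by case/orP => /eqP M0; apply: flag_block_eq0 M0 _; rewrite leqnn rc.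
apply: leq_trans (subset_leq_card sub) _.
(* Counting all [2 ^ n] subsets instead of the small ones is crude, but the factor does not depend
   on [#|F|], which is all that matters. *)
apply: leq_trans (_ : \sum_(S | P S) #|F| ^ ((t * (t + 1)) %/ 2) <= _)%N; last first.
  have := card_powerset [set: 'I_n]; rewrite cardsT card_ord => <-.
  rewrite sum_nat_const leq_mul2r.
  apply/orP; right; apply/subset_leq_card/subsetP => S _.
  by rewrite inE subsetT.
apply: leq_trans (_ : \sum_(S | P S) #|supported_on F n (upper_pairs n S)| <= _)%N.
  elim/big_rec2: _ => [|S k A _ IH]; first by rewrite cards0.
  by rewrite (leq_trans (leq_card_setU _ _)) // leq_add2l.
apply: leq_sum => S tS; rewrite card_supported_on card_upper_pairs leq_pexp2l //.
by rewrite leq_div2r // leq_mul // leq_add2r.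
Qed.

(** * A large space of small flag rank *)

Lemma mxrank_le_ncols (F : fieldType) (m n k : nat) (A : 'M[F]_(m, n)) :
  (forall i (j : 'I_n), (k <= j)%N -> A i j = 0) -> (\rank A <= k)%N.
Proof.
(* Right multiplication by [pid_mx k] erases the columns from [k] on, which are zero already. *)
move=> A0; have -> : A = A *m pid_mx k :> 'M_(m, n).
  apply/matrixP => i j; rewrite mxE (bigD1 j) //= big1 => [|l lj].
    by rewrite mxE eqxx /= addr0; case: ltnP => [_|/A0 ->]; rewrite ?mulr1 ?mul0r.
  by rewrite mxE (_ : (l == j :> nat) = false) ?mulr0 //; apply/negbTE.
apply: leq_trans (mxrankM_maxr _ _) _.
case: (leqP k n) => kn; first by rewrite rank_pid_mx.
by apply: leq_trans (rank_leq_col _) (ltnW kn).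
Qed.

(** The position [(d, d)] lies in block [d] only. It adds one dimension, enough to exceed the
    exponent in the ball bound when [d] is the radius, at the cost of at most one unit of flag
    rank. *)
Definition corner_pairs (n : nat) (d : 'I_n) : {set 'I_n * 'I_n} :=
  (d, d) |: upper_pairs n [set i : 'I_n | (i < d)%N].

Lemma card_corner_pairs (n : nat) (d : 'I_n) :
  #|corner_pairs n d| = ((d * (d + 1)) %/ 2).+1.
Proof.
rewrite cardsU1 !inE /= ltnn card_upper_pairs add1n.
have -> // : #|[set i : 'I_n | (i < d)%N]| = d.
by rewrite cardsE -sum1_card (big_ord_narrow (ltnW (ltn_ord d))) sum1_card card_ord.
Qed.

(** For [i < d], block [i] has [i.+1] rows and vanishes beyond its first [d - i] columns; block [d]
    has nonzero entries only in its first column; later blocks are zero. *)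
Lemma flag_rank_corner (F : finFieldType) (n : nat) (d : 'I_n) (M : 'M[F]_n) :
    M \in supported_on F n (corner_pairs n d) ->
  (flag_rank M <= (\sum_(0 <= i < d) minn i.+1 (d - i)).+1)%N.
Proof.
move=> /supported_onP M0.
pose f i := if (i < d)%N then minn i.+1 (d - i) else (i == d) : nat.
have -> : (\sum_(0 <= i < d) minn i.+1 (d - i)).+1 = (\sum_(i < n) f i)%N.
  rewrite -(big_mkord xpredT f) (big_cat_nat (leq0n d) (ltnW (ltn_ord d))) /=.
  rewrite (big_ltn (ltn_ord d)) {2}/f ltnn eqxx add1n.
  rewrite [X in (_ + X.+1)%N]big_nat_cond [X in (_ + X.+1)%N]big1 ?addn1.
    congr _.+1; rewrite [LHS]big_nat [RHS]big_nat.
    by apply: eq_bigr => i; rewrite /f /= => ->.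
  by move=> i /andP [/andP [di _] _]; rewrite /f ltnNge (ltnW di) /= gtn_eqF.
apply: leq_sum => i _; rewrite /f.
case: (ltngtP i d) => [id | di | /val_inj ->].
- rewrite leq_min rank_leq_row; apply: mxrank_le_ncols => r c dc.
  rewrite mxE M0 // !inE !xpair_eqE -!val_eqE /=.
  by have := ltn_ord r; lia.
- rewrite leqn0 mxrank_eq0; apply/eqP/matrixP => r c.
  by rewrite !mxE M0 // !inE !xpair_eqE -!val_eqE /=; lia.
- apply: mxrank_le_ncols => r c c0.
  by rewrite mxE M0 // !inE !xpair_eqE -!val_eqE /=; lia.
Qed.

Lemma supported_onB (F : finFieldType) (n : nat) (D : {set 'I_n * 'I_n}) A B :
    A \in supported_on F n D -> B \in supported_on F n D ->
  A - B \in supported_on F n D.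
Proof.
move=> /supported_onP A0 /supported_onP B0; apply/supported_onP => r c rc.
by rewrite !mxE A0 // B0 // subr0.
Qed.

(** Two subspaces that meet trivially form a direct sum, here inside the upper triangular matrices:
    [h] is injective on pairs because [A - B = X - Y] lies in both subspaces. *)
Lemma card_supported_on_code (F : finFieldType) (n : nat)
    (D : {set 'I_n * 'I_n}) (C : {vspace 'M[F]_n}) :
    linear_flag_code C -> D \subset upper_pairs n setT ->
    (forall M, M \in C -> M \in supported_on F n D -> M = 0) ->
  (#|supported_on F n D| * #|C| <= #|F| ^ ((n * (n + 1)) %/ 2))%N.
Proof.
move=> utC sD CD0; rewrite -card_upper_trig -(cardsE (mem C)) -cardsX.
pose h (p : 'M[F]_n * 'M[F]_n) := p.1 - p.2.
have utD M : M \in supported_on F n D ->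
    M \in supported_on F n (upper_pairs n setT).
  move=> /supported_onP M0; apply/supported_onP => r c rc.
  by apply: M0; apply: contra rc; apply: (subsetP sD).
rewrite -(card_in_imset (f := h)) => [|[A X] [B Y]].
  apply/subset_leq_card/subsetP => _ /imsetP [[A X] AX ->].
  move: AX; rewrite in_setX [_ \in [set _ in C]]inE /= => /andP [AD XC].
  rewrite inE /h upper_trigE supported_onB //.
    exact: utD.
  by rewrite -upper_trigE utC.
rewrite !in_setX /= ![_ \in [set _ in C]]inE => /andP [AD XC].
move=> /andP [BD YC]; rewrite /h /= => AXBY.
have AB : A - B = X - Y.
  by rewrite -[A](subrK X) AXBY addrAC [_ - B]addrAC subrr add0r addrC.
have AB0 : A - B = 0.
  by apply: CD0; [rewrite AB memvB | rewrite supported_onB].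
congr pair; first exact: subr0_eq.
by apply: subr0_eq; rewrite -AB.
Qed.

(** Only upper bounds on the floors [a] and [b] are needed: [a * a <= 2t] and [b * (b + 1) <= 2t].
    They turn the hypothesis into an integer inequality, settled by finitely many cases. *)
Lemma radius_bound (R : realType) (t : nat) :
    ((t%:R * (t%:R + 1)) / 2 <
      ((2 * t + 1)%:R - 1)
      + (Num.floor (Num.sqrt ((2 * t + 1)%:R - 1 : R)))%:~R
        * (Num.floor ((Num.sqrt (4 * ((2 * t + 1)%:R - 1) + 1 : R) - 1) / 2))%:~R
      :> R) ->
  (0 < t <= 5)%N.
Proof.
set x : R := t%:R.
have x0 : 0 <= x by rewrite ler0n.
have -> : (2 * t + 1)%:R - 1 = 2 * x :> R by rewrite natrD natrM addrK.
set s1 := Num.sqrt (2 * x); set s2 := Num.sqrt (4 * (2 * x) + 1).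
have s1E : s1 ^+ 2 = 2 * x by rewrite sqr_sqrtr //; lra.
have s2E : s2 ^+ 2 = 4 * (2 * x) + 1 by rewrite sqr_sqrtr //; lra.
have s10 : 0 <= s1 by rewrite sqrtr_ge0.
have s21 : 1 <= s2 by rewrite -[leLHS]sqrtr1 ler_wsqrtr //; lra.
have s20 : 0 <= (s2 - 1) / 2 by lra.
have a0 : 0 <= Num.floor s1 by rewrite floor_ge0.
have b0 : 0 <= Num.floor ((s2 - 1) / 2) by rewrite floor_ge0.
have := floor_le s1; have := floor_le ((s2 - 1) / 2).
move: a0 b0; set a := Num.floor s1; set b := Num.floor _ => a0 b0 bs as1 H.
have a0R : 0 <= a%:~R :> R by rewrite ler0z.
have b0R : 0 <= b%:~R :> R by rewrite ler0z.
have Ha : a%:~R * a%:~R <= 2 * x by rewrite -s1E expr2 ler_pM.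
(* The number [(s2 - 1) / 2] is the nonnegative root of [y * (y + 1) = 2 * x]. *)
have Hb : b%:~R * (b%:~R + 1) <= 2 * x by nra.
have {}H : x * (x + 1) < 4 * x + 2 * (a%:~R * b%:~R) by lra.
have {}Ha : a * a <= 2 * t%:Z by rewrite -(ler_int R) !intrM.
have {}Hb : b * (b + 1) <= 2 * t%:Z by rewrite -(ler_int R) !intrM intrD.
have {}H : t%:Z * (t%:Z + 1) < 4 * t%:Z + 2 * (a * b).
  by rewrite -(ltr_int R) !(intrM, intrD).
clearbody a b; clear - a0 b0 Ha Hb H.
have ab : 2 * (a * b) <= a * a + b * b.
  by have := sqr_ge0 (a - b); rewrite expr2 !(mulrBl, mulrBr) (mulrC b a); lia.
(* Since [2ab <= a * a + b * b <= 4t], the hypothesis gives [t * (t + 1) < 8t]. *)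
have t6 : (t <= 6)%N.
  rewrite leqNgt; apply/negP => t7.
  have : t%:Z * t%:Z >= 7 * t%:Z by apply: ler_wpM2r; lia.
  by rewrite !mulrDr in H Hb; lia.
(* These bounds exclude [t = 6], where [24 + 2 * 9 = 42 = 6 * 7] leaves no strict inequality. *)
have a3 : a <= 3 by nia.
have b3 : b <= 3 by nia.
have ab9 : a * b <= 9 by nia.
case: t t6 Ha Hb H => [|[|[|[|[|[|[|t]]]]]]] //; rewrite ?mulrDr; lia.
Qed.

Theorem proposition5p16 (R : realType) (n t delta : nat)
    (hn : (1 <= n)%N) (ht : (t < n)%N) (hdelta : delta = (2 * t + 1)%N)
    (hineq :
      (t%:R * (t%:R + 1)) / 2 <
      (delta%:R - 1)
      + (Num.floor (Num.sqrt (delta%:R - 1 : R)))%:~R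
        * (Num.floor ((Num.sqrt (4 * (delta%:R - 1) + 1 : R) - 1) / 2))%:~R :> R) :
  exists q0 : nat,
    forall F : finFieldType, (q0 <= #|F|)%N ->
      ~ exists C : {vspace 'M[F]_n},
          [/\ linear_flag_code C, min_distance C delta
            & perfect_code C delta].
Proof.
subst delta; have /andP [t_gt0 t_le5] := radius_bound R t hineq.
exists (2 ^ n).+1 => F qF [C [utC [_ minC] perfC]].
have F_gt0 : (0 < #|F|)%N by apply: leq_trans qF.
(* The assumption [t < n] leaves room for the extra diagonal entry at index [t]. *)
pose d := Ordinal ht.
have sD : corner_pairs n d \subset upper_pairs n setT.
  apply/subsetP => -[r c]; rewrite !inE xpair_eqE /=.
  by case/orP => [/andP [/eqP -> /eqP ->] // | /and3P []].
have CD0 M : M \in C -> M \in supported_on F n (corner_pairs n d) -> M = 0.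
  move=> MC /flag_rank_corner frM; apply/eqP; apply: contraT => M0.
  suff : (flag_rank M <= 2 * t)%N by have := minC M MC M0; lia.
  apply: leq_trans frM _ => /=.
  (* For [t = 1, ..., 5] the bound is 2, 3, 5, 7, 10, never above [2 * t]; for [t = 6] it would be
     13. *)
  by move: t_gt0 t_le5; case: (t) => [|[|[|[|[|[|]]]]]] // _ _; rewrite unlock.
have := card_supported_on_code F n _ C utC sD CD0.
rewrite -perfC mulnC leq_pmul2l; last by apply/card_gt0P; exists 0; rewrite mem0v.
(* With [#|C|] cancelled and the radius simplified to [t], the ball has at least [#|F|] to the power
   [t(t+1)/2 + 1] elements. *)
rewrite addnK mulKn // card_supported_on card_corner_pairs /= => ball_ge.
have := leq_trans ball_ge (ball_size_le F n t).
by rewrite expnS leq_pmul2r ?expn_gt0 ?F_gt0 // leqNgt qF.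
Qed.
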